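(* Let $G$ be a group and let $R$ be a $G$-graded ring. If $(R,G)$ is non-degenerate, then $(R,G)$ is weak.
   Context: A ring $R$ with unity $1$ is $G$-graded if $R=\bigoplus_{g\in G}R_g$ for additive subgroups $R_g$ with $R_gR_h\subseteq R_{gh}$ for all $g,h\in G$. $(R,G)$ is non-degenerate if for all $g\in G$ and all $a_g\in R_g\setminus\{0\}$ we have $a_gR_{g^{-1}}\neq\{0\}$ and $R_{g^{-1}}a_g\neq\{0\}$. $(R,G)$ is weak if for every $g\in G$, $R_g=\{0\}$ implies $R_{g^{-1}}=\{0\}$. *)

(* Defs.v *)
From mathcomp Require Import all_boot all_algebra.
From mathcomp Require Import boolp classical_sets functions cardinality fsbigop.

Set Implicit Arguments.
Unset Strict Implicit.
Unset Printing Implicit Defensive.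

Import GRing.Theory.

Local Open Scope classical_set_scope.
Local Open Scope ring_scope.

(* Internal direct sum.  The finiteness of the support is required separately
   because [\sum_(i \in A)] is 0 by convention on families of infinite support. *)
Definition internal_direct_sum (I : choiceType) (V : zmodType)
    (V_ : I -> set V) : Prop :=
  forall v : V, exists! x : I -> V,
    [/\ forall i, V_ i (x i),
        finite_set [set i | x i != 0]
      & v = \sum_(i \in [set: I]) x i].

(* R_g R_h is contained in R_gh iff R_gh contains all the products of an element
   of R_g and an element of R_h, since R_gh is an additive subgroup. *)
Definition graded (G : groupType) (R : pzRingType) (R_ : G -> set R) : Prop :=
  [/\ forall g, zmod_closed (mem (R_ g)),
      internal_direct_sum R_
    & forall g h a b, R_ g a -> R_ h b -> R_ (g * h)%g (a * b)].

Definition non_degenerate (G : groupType) (R : pzRingType) (R_ : G -> set R)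
    : Prop :=
  forall g a, (R_ g `\ 0) a ->
    [set a * b | b in R_ (g^-1)%g] <> [set 0] /\
    [set b * a | b in R_ (g^-1)%g] <> [set 0].

Definition weak (G : groupType) (R : pzRingType) (R_ : G -> set R) : Prop :=
  forall g, R_ g = [set 0] -> R_ (g^-1)%g = [set 0].

(* Main.v *)
Require Import Defs.
From mathcomp Require Import all_boot all_algebra.
From mathcomp Require Import classical_sets.

Theorem proposition2p5 (G : groupType) (R : pzRingType) (R_ : G -> set R) :
  graded R_ -> non_degenerate R_ -> weak R_.
Proof.
move=> [R_closed _ _] nondeg g Rg0.
(* Equality with [[set 0]] also needs [0] to lie in the component of degree [g^-1], which holds
   because it is an additive subgroup. *)
have [/set_mem R0 _] := R_closed (g^-1)%g.
apply/seteqP; split=> [a Ra | _ ->] //=.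
have [//|a_neq0] := eqVneq a 0%R.
(* Non-degeneracy is applied in degree [g^-1], whose opposite component is [R_ g] itself: a nonzero
   [a] would give [a * R_ g <> {0}], whereas [R_ g = {0}] leaves only the product [a * 0 = 0]. *)
have [] := nondeg (g^-1)%g a; first by split=> //; apply/eqP.
by rewrite invgK Rg0 image_set1 GRing.mulr0.
Qed.
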